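(* Let $r\geq 2$ be an integer and let $H$ be an $r$-partite $r$-graph with $h$ vertices and $\ell$ edges. Let $\alpha$ and $A$ be positive reals such that $A\geq r^{2r}$, $\alpha>r-\frac{1}{m_r(H)}$, and $\mathrm{ex}(n,H)\leq An^\alpha$ for all $n$. Then there exist constants $k_0, C>0$ such that the following holds. Let $G$ be an $n$-vertex $r$-graph with $m=kn^\alpha$ edges, where $k\geq k_0$. Then $G$ contains a non-empty family $\mathcal{H}$ of copies of $H$ such that \[d_{\mathcal{H}}(S)\leq C\,k^{-\lambda(\alpha,H)(|S|-1)}\frac{|\mathcal{H}|}{e(G)}\quad\text{for every } S\subseteq E(G) \text{ with } 1\leq |S|\leq e(H),\] where $\lambda(\alpha,H)=\frac{1}{m_r(H)(r-\alpha)}$.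
   Context: An $r$-graph is an $r$-uniform hypergraph. $\mathrm{ex}(n,H)$ is the maximum number of edges in an $n$-vertex $r$-graph containing no copy of $H$. For a family $\mathcal{H}$ of copies of $H$ in $G$ (each viewed as a set of edges of $G$) and $S\subseteq E(G)$, $d_{\mathcal{H}}(S)=|\{A\in\mathcal{H}: S\subseteq A\}|$. The $r$-density of an $r$-graph $H$ with $v(H)\geq r+1$ is $m_r(H)=\max\{\frac{e(F)-1}{v(F)-r}: F\subseteq H,\ v(F)>r\}$. $H$ is assumed to have at least two edges. *)

(* Defs.v *)
From HB Require Import structures.
From mathcomp Require Import all_boot all_order all_algebra.

Set Implicit Arguments.
Unset Strict Implicit.
Unset Printing Implicit Defensive.

Import Order.TTheory GRing.Theory Num.Theory.
Local Open Scope ring_scope.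

(* A hypergraph with vertex type V is its edge set E : {set {set V}}, so
   v(E) = #|V| and e(E) = #|E|. Isolated vertices are allowed. *)

Definition uniform (r : nat) (V : finType) (E : {set {set V}}) : bool :=
  [forall e in E, #|e| == r].

Definition rpartite (r : nat) (V : finType) (E : {set {set V}}) : Prop :=
  exists part : V -> 'I_r,
    forall e, e \in E -> forall i, #|[set v in e | part v == i]| = 1%N.

(* The copies of H in G, each viewed as a set of edges of G. The embedding is
   injective on all vertices of H, the isolated ones included. *)
Definition copies (V W : finType) (H : {set {set V}}) (G : {set {set W}}) :
    {set {set {set W}}} :=
  [set A : {set {set W}} | (A \subset G) &&
    [exists f : {ffun V -> W}, injectiveb f &&
       (A == [set f @: (e : {set V}) | e in H])]].

(* ex(n, H). When H has an edge, the edgeless graph is always admissible, so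
   the maximum is over a nonempty range. *)
Definition ex (r : nat) (V : finType) (H : {set {set V}}) (n : nat) : nat :=
  \max_(G : {set {set 'I_n}} | uniform r G && (copies H G == set0)) #|G|.

Definition codegree (W : finType) (F : {set {set {set W}}})
    (S : {set {set W}}) : nat :=
  #|[set A in F | S \subset A]|.

(* A subgraph of H is a pair F = (V(F), E(F)). *)
Definition subgraph (V : finType) (H : {set {set V}})
    (F : {set V} * {set {set V}}) : bool :=
  (F.2 \subset H) && [forall e in F.2, e \subset F.1].

Definition density_ratio (R : realFieldType) (r : nat) (V : finType)
    (F : {set V} * {set {set V}}) : R :=
  (#|F.2|%:R - 1) / (#|F.1|%:R - r%:R).

(* m_r(H), meaningful when v(H) > r. The initial value of the iterated maximum
   is the ratio of H itself, which is then one of the competing subgraphs. *)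
Definition rdensity (R : realFieldType) (r : nat) (V : finType)
    (H : {set {set V}}) : R :=
  \big[Num.max/density_ratio R r (setT, H)]_(F : {set V} * {set {set V}}
      | subgraph H F && (r < #|F.1|)%N) density_ratio R r F.

Definition lambda (R : realFieldType) (r : nat) (alpha : R) (V : finType)
    (H : {set {set V}}) : R :=
  (rdensity R r H * (r%:R - alpha))^-1.

(* Main.v *)
(** Take a largest family [F] of copies of [H] in which every set [S] of edges
    lies in at most [k ^ (lambda (e(H) - |S|))] members; the claim is that
    [|F| >= m k ^ (lambda (e(H) - 1)) / C].  Otherwise few sets [S] are saturated.
    Average over the [t]-sets of vertices, where [t] is about
    [n (2 A r^r / k) ^ (1 / (r - alpha))].  A saturated [S] survives with
    probability at most [(t/n) ^ (v(S) - r)] times that of an edge, and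
    [|S| - 1 <= m_r(H) (v(S) - r)], so on average at least half of the surviving
    edges remain after deleting one edge from each surviving saturated set, which
    is more than [A t ^ alpha].  Hence some copy of [H] contains no saturated set
    and can be added to [F]. *)

Require Import Defs.
From HB Require Import structures.
From mathcomp Require Import all_boot all_order all_algebra.
From mathcomp Require Import reals exp.
From mathcomp Require Import zify ring lra.

Set Implicit Arguments.
Unset Strict Implicit.
Unset Printing Implicit Defensive.

Import Order.TTheory GRing.Theory Num.Theory.
Local Open Scope ring_scope.

(** * Counting [t]-sets that contain a given set *)

(** Complementation turns these sets into subsets of [~: X]. Choosing [#|V| - t] elements rather
    than [t - #|X|] keeps the formula right when [#|X| > t]: the binomial is then 0. *)
Lemma card_supersets (V : finType) (X : {set V}) (t : nat) :
  (t <= #|V|)%N ->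
  #|[set U : {set V} | (X \subset U) && (#|U| == t)]| =
    'C(#|V| - #|X|, #|V| - t).
Proof.
move=> le_tV; have -> : (#|V| - #|X|)%N = #|~: X| by rewrite [RHS]cardsCs setCK.
rewrite -cards_draws -(card_imset _ (inv_inj setCK)).
apply: eq_card => U; rewrite inE.
apply/imsetP/andP => [[W]|[sUX /eqP cU]].
  rewrite inE => /andP[sXW /eqP cW] ->.
  by rewrite setCS sXW cardsCs setCK cW.
exists (~: U); last by rewrite setCK.
by rewrite inE subsetC sUX cardsCs setCK cU subKn ?eqxx.
Qed.

Lemma bin_step (n t v : nat) : (t <= n)%N ->
  ((n - v) * 'C(n - v.+1, n - t) = (t - v) * 'C(n - v, n - t))%N.
Proof.
move=> le_tn; rewrite subnS mul_bin_down; congr (_ * _)%N; lia.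
Qed.

(** Each vertex beyond the first [r] costs a factor [(t - v) / (n - v) <= t / n] in the probability
    of lying in a random [t]-set. *)
Lemma bin_ratio_le (n t r i : nat) : (t <= n)%N ->
  (n ^ i * 'C(n - (r + i), n - t) <= t ^ i * 'C(n - r, n - t))%N.
Proof.
move=> le_tn; elim: i => [|i IHi]; first by rewrite addn0.
(* The factor [n - (r + i)] cancelled below vanishes here. Either [t = n] and all binomials are 1,
   or the left one is 0. *)
have [le_nv|lt_vn] := leqP n (r + i).
  have [->|lt_tn] := eqVneq t n.
    by rewrite subnn !bin0.
  by rewrite [X in (_ * X <= _)%N]bin_small ?muln0 //; lia.
rewrite addnS !expnS.
have step := bin_step (r + i) le_tn.
set a := 'C(n - (r + i).+1, _) in step *; set b := 'C(n - (r + i), _) in IHi step.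
have le1 : (n * a <= t * b)%N.
  rewrite -(leq_pmul2l (m := n - (r + i))); last by rewrite subn_gt0.
  rewrite mulnCA step !mulnA leq_mul2r [X in (_ <= X)%N]mulnC !mulnBr [(t * n)%N]mulnC.
  by rewrite leq_sub2l ?orbT // leq_mul2r le_tn orbT.
rewrite -mulnA [X in (_ <= X)%N]mulnAC mulnCA; nia.
Qed.

(** For [v < r <= t] one has [t <= (t - v) * r], so each of the first [r] vertices costs at least a
    factor [t / (n * r)]. With [v = r] this bounds below the survival probability of an edge. *)
Lemma bin_ratio_ge (n t r v : nat) : (r <= t)%N -> (t <= n)%N -> (v <= r)%N ->
  (t ^ v * 'C(n, n - t) <= (n * r) ^ v * 'C(n - v, n - t))%N.
Proof.
move=> le_rt le_tn; elim: v => [|v IHv] lt_vr; first by rewrite subn0.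
have {}IHv := IHv (ltnW lt_vr).
have step := bin_step v le_tn; rewrite !expnS.
set a := 'C(n - v.+1, _) in step *; set b := 'C(n - v, _) in IHv step.
have le1 : (t * b <= n * r * a)%N.
  apply: (@leq_trans ((t - v) * b * r)%N); last by rewrite -step; nia.
  suff : (t <= (t - v) * r)%N by nia.
  rewrite mulnBl leq_subRL; nia.
nia.
Qed.

(** * Copies forced by the extremal number *)

Lemma copies_lift (V U W : finType) (H : {set {set V}}) (G : {set {set W}})
    (g : U -> W) (G0 : {set {set U}}) :
  injective g -> (forall e, e \in G0 -> g @: e \in G) ->
  copies H G0 != set0 -> copies H G != set0.
Proof.
move=> inj_g sG0 /set0Pn[A]; rewrite inE => /andP[sA /existsP[f /andP[inj_f /eqP defA]]].
apply/set0Pn; exists [set g @: (e : {set U}) | e in A].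
rewrite inE; apply/andP; split.
  by apply/subsetP=> _ /imsetP[e eA ->]; apply: sG0; apply: (subsetP sA).
apply/existsP; exists [ffun x => g (f x)]; apply/andP; split.
  by apply/injectiveP => x y; rewrite !ffunE => /inj_g; apply: (injectiveP _ inj_f).
rewrite defA -imset_comp; apply/eqP/eq_imset => e /=.
by rewrite -imset_comp; apply: eq_imset => x /=; rewrite ffunE.
Qed.

(** All edges lie inside [U], so numbering [U] by [enum_val] moves [G] to a graph on ['I_#|U|], the
    vertex type over which [ex] is defined. *)
Lemma ex_lt_copies (r : nat) (V W : finType) (H : {set {set V}})
    (G : {set {set W}}) (U : {set W}) :
  uniform r G -> cover G \subset U -> (ex r H #|U| < #|G|)%N ->
  copies H G != set0.
Proof.
move=> unifG sGU ltG.
pose g (i : 'I_#|U|) := enum_val i.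
have inj_g : injective g by exact: enum_val_inj.
have gK e : e \in G -> g @: (g @^-1: e) = e.
  move=> eG; apply/setP=> x; apply/imsetP/idP => [[i]|xe].
    by rewrite inE => ? ->.
  have xU : x \in U by apply: (subsetP sGU); apply/bigcupP; exists e.
  by exists (enum_rank_in xU x); rewrite ?inE /g enum_rankK_in.
pose G0 := [set g @^-1: (e : {set W}) | e in G].
have cG0 : #|G0| = #|G|.
  by apply: card_in_imset => e e' eG e'G eq_e; rewrite -(gK e) // eq_e gK.
have sG0 e : e \in G0 -> g @: e \in G.
  by case/imsetP=> e' e'G ->; rewrite gK.
apply: (copies_lift inj_g sG0); apply/negP => /eqP G0free.
have unifG0 : uniform r G0.
  apply/forall_inP => e eG0; rewrite -(card_imset _ inj_g).
  exact: (forall_inP unifG _ (sG0 _ eG0)).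
suff : (#|G0| <= ex r H #|U|)%N by rewrite cG0 leqNgt ltG.
by apply: leq_bigmax_cond; rewrite unifG0 G0free eqxx.
Qed.

(* Deleting one edge from each set of [B] inside [U] leaves too many edges for
   an [H]-free graph. *)
Lemma ex_lt_copies_avoiding (r : nat) (V W : finType) (H : {set {set V}})
    (G : {set {set W}}) (B : {set {set {set W}}}) (U : {set W}) :
  uniform r G -> set0 \notin B ->
  (ex r H #|U| + #|[set S in B | cover S \subset U]| <
     #|[set e in G | e \subset U]|)%N ->
  exists2 A, A \in copies H G & forall S, S \in B -> ~~ (S \subset A).
Proof.
move=> unifG B0 ltG.
pose BU := [set S in B | cover S \subset U].
(* The default [set0] never occurs, since no member of [B] is empty. *)
pose D := [set odflt set0 [pick e in (S : {set {set W}})] | S in BU].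
pose GU := [set e in G | e \subset U].
have leD : (#|D| <= #|BU|)%N by exact: leq_imset_card.
have ltGD : (ex r H #|U| < #|GU :\: D|)%N.
  rewrite cardsD ltn_subRL addnC; apply: leq_ltn_trans ltG; rewrite leq_add2l.
  exact: leq_trans (subset_leq_card (subsetIr GU D)) leD.
have unifGD : uniform r (GU :\: D).
  by apply/forall_inP => e; rewrite !inE => /and3P[_ eG _]; apply: (forall_inP unifG).
have covGD : cover (GU :\: D) \subset U.
  by apply/bigcupsP => e; rewrite !inE => /and3P[].
have /set0Pn[A] := ex_lt_copies unifGD covGD ltGD.
rewrite inE => /andP[sA copA]; exists A.
  rewrite inE copA andbT; apply: (subset_trans sA); apply/subsetP=> e.
  by rewrite !inE => /and3P[].
move=> S SB; apply/negP=> sSA.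
have SBU : S \in BU.
  rewrite inE SB; apply/bigcupsP => e eS.
  by have := subsetP sA _ (subsetP sSA _ eS); rewrite !inE => /and3P[].
have := imset_f (fun S : {set {set W}} => odflt set0 [pick e in S]) SBU.
rewrite -/D /=; case: pickP => [e eS|S0] /= eD.
  by have := subsetP sA _ (subsetP sSA _ eS); rewrite inE eD.
by case/negP: B0; have <- : S = set0 by apply/setP=> e; rewrite inE; exact: S0.
Qed.

(** * Double counting, and the density of parts of copies *)

Lemma sum_card_exchange (I J : finType) (P : pred J) (X : {set I})
    (rel : I -> J -> bool) :
  (\sum_(j | P j) #|[set i in X | rel i j]| =
    \sum_(i in X) #|[set j | rel i j && P j]|)%N.
Proof.
under eq_bigr do rewrite -sum1dep_card.
rewrite (exchange_big_dep (mem X)) /=; last by move=> j i _ /andP[].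
apply: eq_bigr => i iX; rewrite -sum1dep_card; apply: eq_bigl => j.
by rewrite iX andbC.
Qed.

Lemma card_imset_injective (V W : finType) (f : V -> W) (H : {set {set V}}) :
  injective f -> #|[set f @: (e : {set V}) | e in H]| = #|H|.
Proof. by move=> inj_f; apply: card_imset; apply: imset_inj. Qed.

Lemma copies_card (V W : finType) (H : {set {set V}}) (G A : {set {set W}}) :
  A \in copies H G -> #|A| = #|H|.
Proof.
rewrite inE => /andP[_ /existsP[f /andP[/injectiveP inj_f /eqP->]]].
exact: card_imset_injective.
Qed.

Lemma cover_imset (V W : finType) (f : V -> W) (H : {set {set V}}) :
  cover [set f @: (e : {set V}) | e in H] = f @: cover H.
Proof.
apply/setP=> x; apply/bigcupP/imsetP => [[_ /imsetP[e eH ->] /imsetP[y ye ->]]|].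
  by exists y => //; apply/bigcupP; exists e.
case=> y /bigcupP[e eH ye] ->; exists (f @: e); first exact: imset_f.
exact: imset_f.
Qed.

Lemma subset_imsetE (T T' : finType) (f : T -> T') (X : {set T}) (Y : {set T'}) :
  Y \subset f @: X -> exists2 Z : {set T}, Z \subset X & Y = f @: Z.
Proof.
move=> sY; exists (X :&: f @^-1: Y); first exact: subsetIl.
apply/setP=> y; apply/idP/imsetP => [yY|[x]].
  have /imsetP[x xX def_y] := subsetP sY _ yY.
  by exists x; rewrite // !inE xX -def_y.
by rewrite !inE => /andP[_ ?] ->.
Qed.
Lemma uniform_cover_ge (r : nat) (V : finType) (H : {set {set V}}) :
  uniform r H -> H != set0 -> (r <= #|cover H|)%N.
Proof.
move=> unifH /set0Pn[e eH]; rewrite -(eqP (forall_inP unifH _ eH)).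
by apply: subset_leq_card; apply: bigcup_sup.
Qed.

(** If only [r] vertices were covered, every edge would equal the cover, leaving at most one
    edge. *)
Lemma uniform_cover_gt (r : nat) (V : finType) (H : {set {set V}}) :
  uniform r H -> (1 < #|H|)%N -> (r < #|cover H|)%N.
Proof.
move=> unifH gt1H; rewrite ltn_neqAle uniform_cover_ge ?andbT //; last first.
  by rewrite -card_gt0 ltnW.
apply: contraL gt1H => /eqP eq_r; rewrite -leqNgt -(cards1 (cover H)).
apply/subset_leq_card/subsetP => e eH; rewrite inE eqEcard (bigcup_sup e) //=.
by rewrite -eq_r (eqP (forall_inP unifH _ eH)).
Qed.

Lemma rdensity_ge (R : realFieldType) (r : nat) (V : finType)
    (H : {set {set V}}) (F : {set V} * {set {set V}}) :
  subgraph H F -> (r < #|F.1|)%N -> density_ratio R r F <= rdensity R r H.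
Proof. by move=> sFH gtF; apply: le_bigmax_cond; rewrite sFH. Qed.

Lemma rdensity_gt0 (R : realFieldType) (r : nat) (V : finType)
    (H : {set {set V}}) :
  uniform r H -> (1 < #|H|)%N -> 0 < rdensity R r H.
Proof.
move=> unifH gt1H; have ltr : (r < #|[set: V]|)%N.
  by apply: leq_trans (uniform_cover_gt unifH gt1H) (subset_leq_card (subsetT _)).
apply: lt_le_trans (@rdensity_ge R r V H (setT, H) _ _) => //.
  by rewrite divr_gt0 ?subr_gt0 ?ltr_nat ?ltr1n.
by rewrite /subgraph subxx; apply/forall_inP => e _; apply: subsetT.
Qed.

(** With two or more edges, [(cover F, F)] competes in the maximum defining the density; with one
    edge the left side is 0. *)
Lemma card_edges_le_rdensity (R : realFieldType) (r : nat) (V : finType)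
    (H F : {set {set V}}) :
  uniform r H -> F \subset H -> F != set0 -> (1 < #|H|)%N ->
  #|F|%:R - 1 <= rdensity R r H * (#|cover F| - r)%:R.
Proof.
move=> unifH sFH F0 gt1H.
have unifF : uniform r F.
  by apply/forall_inP => e eF; apply: (forall_inP unifH); apply: (subsetP sFH).
have [le1F|gt1F] := leqP #|F| 1.
  apply: (@le_trans _ _ 0); first by rewrite subr_le0 lern1.
  by rewrite mulr_ge0 // ltW // rdensity_gt0.
have ltr := uniform_cover_gt unifF gt1F.
rewrite natrB ?(ltnW ltr) // -ler_pdivrMr ?subr_gt0 ?ltr_nat //.
apply: (@rdensity_ge R r V H (cover F, F)) => //.
by rewrite /subgraph sFH; apply/forall_inP => e eF; apply: bigcup_sup.
Qed.

(** The embedding pulls [S] back to a subgraph of [H] with as many edges and as many covered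
    vertices. *)
Lemma copy_subset_density (R : realFieldType) (r : nat) (V W : finType)
    (H : {set {set V}}) (G A S : {set {set W}}) :
  uniform r H -> (1 < #|H|)%N -> A \in copies H G -> S \subset A -> S != set0 ->
  #|S|%:R - 1 <= rdensity R r H * (#|cover S| - r)%:R.
Proof.
move=> unifH gt1H; rewrite inE => /andP[_ /existsP[f /andP[/injectiveP inj_f /eqP->]]].
case/subset_imsetE => F sFH -> F0.
rewrite card_imset_injective // cover_imset (card_imset _ inj_f).
apply: card_edges_le_rdensity => //.
by apply: contraNneq F0 => ->; rewrite imset0.
Qed.

Lemma sum_codegree (R : realFieldType) (W : finType) (F B : {set {set {set W}}})
    (w : {set {set W}} -> R) :
  \sum_(S in B) (codegree F S)%:R * w S =
    \sum_(A in F) \sum_(S in B | S \subset A) w S.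
Proof.
under eq_bigr => S _ do rewrite mulr_natl -sumr_const.
rewrite (exchange_big_dep (mem F)) /=; last by move=> S A _; rewrite inE => /andP[].
by apply: eq_bigr => A AF; apply: eq_bigl => S; rewrite inE AF.
Qed.

(** * Averaging over the [t]-sets of vertices *)

(** The first numerical hypothesis says that, summed over all [t]-sets [U], the members of [B]
    inside [U] number at most half the edges inside [U]; the second says that the other half exceeds
    [ex r H t] on average. Some [U] then meets the condition of [ex_lt_copies_avoiding]. *)
Lemma copy_avoiding (R : realFieldType) (r t : nat) (V W : finType)
    (H : {set {set V}}) (G : {set {set W}}) (B : {set {set {set W}}}) :
  uniform r G -> set0 \notin B -> (0 < r <= t)%N -> (t <= #|W|)%N ->
  (forall S, S \in B -> r <= #|cover S|)%N ->
  \sum_(S in B) (t%:R / #|W|%:R) ^+ (#|cover S| - r) <= #|G|%:R / 2 :> R ->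
  2 * (#|W| * r)%:R ^+ r * (ex r H t)%:R < t%:R ^+ r * #|G|%:R :> R ->
  exists2 A, A \in copies H G & forall S, S \in B -> ~~ (S \subset A).
Proof.
move=> unifG B0 /andP[r_gt0 le_rt] le_tW geB sumB ltG.
set n := #|W| in le_tW sumB ltG *.
have n_gt0 : (0 < n)%N by lia.
pose e (U : {set W}) := #|[set e in G | e \subset U]|.
pose b (U : {set W}) := #|[set S in B | cover S \subset U]|.
case: (pickP [pred U : {set W} | (#|U| == t) && (ex r H t + b U < e U)%N]).
  move=> U /andP[/eqP cU]; rewrite -cU; exact: ex_lt_copies_avoiding.
move=> no_U; exfalso.
pose N v := 'C(n - v, n - t).
have sumN : (\sum_(U : {set W} | #|U| == t) e U <=
    \sum_(U : {set W} | #|U| == t) (ex r H t + b U))%N.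
  apply: leq_sum => U /eqP cU; have := no_U U.
  by rewrite /= cU eqxx /= ltnNge => /negbFE.
have sum_e : (\sum_(U : {set W} | #|U| == t) e U = #|G| * N r)%N.
  rewrite sum_card_exchange -sum_nat_const; apply: eq_bigr => x xG.
  by rewrite card_supersets // (eqP (forall_inP unifG _ xG)).
have sum_b : (\sum_(U : {set W} | #|U| == t) b U = \sum_(S in B) N #|cover S|)%N.
  rewrite (sum_card_exchange _ _
    (fun (S : {set {set W}}) (U : {set W}) => cover S \subset U)).
  by apply: eq_bigr => S _; rewrite card_supersets.
have cardU : #|[pred U : {set W} | #|U| == t]| = 'C(n, n - t).
  rewrite -[n in 'C(n, _)]subn0 -(cards0 W) -(card_supersets set0) //.
  by apply: eq_card => U; rewrite !inE sub0set.
rewrite big_split /= sum_e sum_b sum_nat_const cardU in sumN.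
have Nle S : S \in B ->
    (N #|cover S|)%:R <= (t%:R / n%:R) ^+ (#|cover S| - r) * (N r)%:R :> R.
  move=> SB; rewrite expr_div_n mulrAC ler_pdivlMr ?exprn_gt0 ?ltr0n //.
  rewrite mulrC -!natrX -!natrM ler_nat.
  by have := bin_ratio_le r (#|cover S| - r) le_tW; rewrite subnKC ?geB.
have sumNB : (\sum_(S in B) N #|cover S|)%:R <= #|G|%:R / 2 * (N r)%:R :> R.
  rewrite natr_sum; apply: le_trans (ler_wpM2r (ler0n _ _) sumB).
  by rewrite mulr_suml; apply: ler_sum => S /Nle.
have C_gt0 : 0 < 'C(n, n - t)%:R :> R by rewrite ltr0n bin_gt0 leq_subr.
have geN : t%:R ^+ r * 'C(n, n - t)%:R <= (n * r)%:R ^+ r * (N r)%:R :> R.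
  by rewrite -!natrX -!natrM ler_nat bin_ratio_ge.
rewrite -(ler_nat R) natrD !natrM in sumN.
rewrite -/n natrM in geN ltG sumNB.
set Nr : R := (N r)%:R in sumN sumNB geN.
have leN : #|G|%:R * Nr <= 2 * ('C(n, n - t)%:R * (ex r H t)%:R) by lra.
set P : R := (n%:R * r%:R) ^+ r in geN ltG.
have P_ge0 : 0 <= P by rewrite exprn_ge0 // mulr_ge0.
(* Chaining [geN] times [#|G|] with [leN] times [P] contradicts [ltG] multiplied by the binomial. *)
have h1 := ler_wpM2l (ler0n R #|G|) geN.
have h2 := ler_wpM2l P_ge0 leN.
have := ltr_pM2l C_gt0 (2 * P * (ex r H t)%:R) (t%:R ^+ r * #|G|%:R).
rewrite ltG => h3; nra.
Qed.

(** * Saturated sets and maximal families *)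

(** One more copy through such an [S] would break the real-valued cap [D]. Positive codegree places
    [S] inside a member of [F], so density bounds for copies apply to it. *)
Definition saturated (R : realFieldType) (W : finType) (D : nat -> R)
    (F : {set {set {set W}}}) : {set {set {set W}}} :=
  [set S | [&& S != set0, (0 < codegree F S)%N &
              D #|S| < (codegree F S)%:R + 1]].

Lemma codegree_gt0P (W : finType) (F : {set {set {set W}}}) (S : {set {set W}}) :
  reflect (exists2 A, A \in F & S \subset A) (0 < codegree F S)%N.
Proof.
rewrite card_gt0; apply: (iffP (set0Pn _)) => -[A].
  by rewrite inE => /andP[]; exists A.
by move=> AF sSA; exists A; rewrite inE AF.
Qed.

Lemma codegreeU1 (W : finType) (F : {set {set {set W}}}) (A S : {set {set W}}) :
  (codegree (A |: F) S <= (S \subset A) + codegree F S)%N.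
Proof.
have [sSA|nsSA] := boolP (S \subset A).
  apply: (@leq_trans #|A |: [set B in F | S \subset B]|).
    apply/subset_leq_card/subsetP => B; rewrite !inE => /andP[/orP[->//|->] ->].
    by rewrite orbT.
  by rewrite cardsU1; case: (_ \notin _).
apply/subset_leq_card/subsetP => B; rewrite !inE => /andP[/orP[/eqP->|->] //].
by rewrite (negPf nsSA).
Qed.

(** A largest family respecting the caps works: if it had fewer than [N] members, the copy supplied
    by [extend] could be added, raising codegrees by one only at unsaturated sets. *)
Lemma balanced_family (R : realFieldType) (V W : finType) (H : {set {set V}})
    (G : {set {set W}}) (D : nat -> R) (N : R) :
  (0 < #|H|)%N -> D #|H| = 1 ->
  (forall j, (0 < j <= #|H|)%N -> 1 <= D j) ->
  (forall F : {set {set {set W}}}, F \subset copies H G -> #|F|%:R < N ->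
    exists2 A, A \in copies H G &
      forall S : {set {set W}}, S \in saturated D F -> ~~ (S \subset A)) ->
  exists F : {set {set {set W}}}, [/\ F \subset copies H G, N <= #|F|%:R &
    forall S : {set {set W}}, (0 < #|S| <= #|H|)%N -> (codegree F S)%:R <= D #|S|].
Proof.
move=> H_gt0 DH geD extend.
pose good (F : {set {set {set W}}}) := (F \subset copies H G) &&
  [forall S : {set {set W}}, (0 < #|S| <= #|H|)%N ==> ((codegree F S)%:R <= D #|S|)].
have good0 : good set0.
  rewrite /good sub0set; apply/forallP => S; apply/implyP => cS.
  rewrite /codegree (_ : [set _ in _ | _] = set0) ?cards0.
    exact: le_trans ler01 (geD _ cS).
  by apply/setP => A; rewrite !inE.
case: (arg_maxnP (fun F : {set {set {set W}}} => #|F|) good0) => F goodF maxF.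
have /andP[sF /forallP degF] := goodF.
exists F; split=> //; last by move=> S; apply: implyP.
rewrite leNgt; apply/negP => ltFN.
have [A copA avoidA] := extend F sF ltFN.
have cA := copies_card copA.
(* Since [D #|H| = 1], every member of [F] is itself saturated, so the new copy cannot be one of
   them. *)
have AnF : A \notin F.
  apply/negP => AF; have degA : (0 < codegree F A)%N by apply/codegree_gt0P; exists A.
  have /avoidA : A \in saturated D F; last by rewrite subxx.
  by rewrite inE -card_gt0 cA H_gt0 degA DH ltrDr ltr0n.
suff /maxF : good (A |: F) by rewrite /= cardsU1 AnF add1n ltnn.
rewrite /good subUset sub1set copA sF; apply/forallP => S; apply/implyP => cS.
apply: (@le_trans _ _ ((S \subset A) + codegree F S)%N%:R).
  by rewrite ler_nat codegreeU1.
have [sSA|_] := boolP (S \subset A); last exact: (implyP (degF S)).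
have nsat : S \notin saturated D F by apply: contraL sSA => /avoidA.
rewrite inE -card_gt0 (andP cS).1 /= in nsat; rewrite natrD addrC.
have [degS|degS] := posnP (codegree F S); first by rewrite degS add0r geD.
by move: nsat; rewrite degS -leNgt.
Qed.

(** For saturated [S], [D #|S| < codegree F S + 1 <= 2 * codegree F S]. Summing codegrees counts
    pairs [S \subset A] with [A] in [F], and each [A] has [2 ^ #|H|] subsets. *)
Lemma sum_saturated_le (R : realFieldType) (V W : finType) (H : {set {set V}})
    (G : {set {set W}}) (D : nat -> R) (F : {set {set {set W}}})
    (w : {set {set W}} -> R) (c : R) :
  F \subset copies H G -> 0 <= c ->
  (forall A S : {set {set W}}, A \in F -> S \subset A -> S != set0 ->
    w S <= c * D #|S|) ->
  \sum_(S in saturated D F) w S <= #|F|%:R * (2 ^+ #|H| * (2 * c)).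
Proof.
move=> sF c_ge0 w_le.
apply: (@le_trans _ _ (\sum_(S in saturated D F) (codegree F S)%:R * (2 * c))).
  apply: ler_sum => S; rewrite inE => /and3P[S0 degS ltD].
  have /codegree_gt0P[A AF sSA] := degS.
  apply: le_trans (w_le A S AF sSA S0) _.
  rewrite mulrCA mulrA mulrC; apply: ler_wpM2r => //.
  have : 1 <= (codegree F S)%:R :> R by rewrite ler1n.
  lra.
rewrite (sum_codegree F (saturated D F) (fun=> 2 * c)) [leRHS]mulr_natl -sumr_const.
apply: ler_sum => A AF; rewrite sumr_const -[leLHS]mulr_natl.
apply: ler_wpM2r; first by rewrite mulr_ge0.
rewrite -natrX ler_nat -(copies_card (subsetP sF _ AF)) -card_powerset.
by apply/subset_leq_card/subsetP => S; rewrite [in X in _ -> X]inE => /andP[].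
Qed.

(** * Choice of the sample size *)

Lemma uniform_card_le (r : nat) (W : finType) (G : {set {set W}}) :
  uniform r G -> (#|G| <= #|W| ^ r)%N.
Proof.
move=> unifG; apply: (@leq_trans 'C(#|W|, r)).
  rewrite -cardsT -cards_draws; apply/subset_leq_card/subsetP => e eG.
  by rewrite inE subsetT (forall_inP unifG).
apply: leq_trans (_ : #|W| ^_ r <= _)%N.
  by rewrite -bin_ffact leq_pmulr ?fact_gt0.
elim: r {unifG} => // r IHr; rewrite ffactnSr expnSr; apply: leq_mul => //.
exact: leq_subr.
Qed.

(** Take [t] to be the floor of [n * q] plus 1, where [q = (B / k) ^ (1 / d)]. Rounding up makes the
    middle inequality strict. The upper bound on [k] gives [r <= n * q], hence [t <= 2 * n * q]; the
    lower bound gives [2 * q <= 1], hence [t <= n]. *)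
Lemma sample_size (R : realType) (n r : nat) (B k d : R) :
  0 < d -> 0 < B -> (0 < n)%N -> (0 < r)%N -> r%:R `^ d <= B ->
  2 `^ d * B <= k -> k <= n%:R `^ d ->
  exists t : nat, [/\ (r <= t <= n)%N, B * n%:R `^ d < k * t%:R `^ d &
    t%:R / n%:R <= 2 * (B / k) `^ d^-1].
Proof.
move=> d_gt0 B_gt0 n_gt0 r_gt0 leB lek kle.
have k_gt0 : 0 < k by apply: lt_le_trans lek; rewrite mulr_gt0 ?powR_gt0.
set q := (B / k) `^ d^-1.
have q_gt0 : 0 < q by rewrite powR_gt0 ?divr_gt0.
have qd : q `^ d = B / k.
  by rewrite /q -powRrM mulVf ?gt_eqF // powRr1 // divr_ge0 // ltW.
have nR_gt0 : 0 < n%:R :> R by rewrite ltr0n.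
have powR_le (x y : R) : 0 <= x -> 0 <= y -> x `^ d <= y `^ d -> x <= y.
  move=> x0 y0; rewrite !leNgt; apply: contra => ltyx.
  by apply: gt0_ltr_powR.
have rle : r%:R <= n%:R * q.
  apply: powR_le; [exact: ler0n | by rewrite mulr_ge0 // ltW |].
  rewrite powRM ?(ltW nR_gt0) ?(ltW q_gt0) // qd.
  apply: le_trans leB _; rewrite mulrA ler_pdivlMr // mulrC.
  by rewrite ler_wpM2r // ltW.
have q2 : 2 * q <= 1.
  apply: powR_le; [by rewrite mulr_ge0 // ltW | exact: ler01 |].
  rewrite powRM ?(ltW q_gt0) // qd powR1.
  by rewrite mulrA ler_pdivrMr // mul1r.
have r_ge1 : 1 <= r%:R :> R by rewrite ler1n.
have nq_ge0 : 0 <= n%:R * q by rewrite mulr_ge0 ?ltW.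
have /andP[tle ltt] := truncn_itv nq_ge0.
set t := Num.truncn _ in tle ltt.
have tle2 : t.+1%:R <= n%:R * (2 * q) by rewrite -addn1 natrD; lra.
exists t.+1; split.
- apply/andP; split; rewrite -(ler_nat R); first by exact: le_trans rle (ltW ltt).
  by apply: le_trans tle2 _; rewrite ler_piMr.
- have := gt0_ltr_powR d_gt0 nq_ge0 (ler0n _ _) ltt.
  rewrite powRM ?(ltW nR_gt0) ?(ltW q_gt0) // qd mulrA ltr_pdivrMr // mulrC.
  by rewrite [ltRHS]mulrC mulrC.
- by rewrite ler_pdivrMr // mulrC.
Qed.
(** As [x <= 1], the exponent [v] may drop to [e / M]; then the bound on [x] is inserted. The
    constant has base at least 1, so raising its exponent to [l / M] makes it independent of [e]. *)
Lemma sample_weight_le (R : realType) (B k d M x e l : R) (v : nat) :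
  0 < B -> 0 < k -> 0 < d -> 0 < M -> 0 < x <= 1 ->
  1 <= 2 * B `^ d^-1 -> x <= 2 * (B / k) `^ d^-1 ->
  0 <= e <= l -> e <= M * v%:R ->
  x ^+ v <= (2 * B `^ d^-1) `^ (l / M) * k `^ (- (M * d)^-1 * e).
Proof.
move=> B_gt0 k_gt0 d_gt0 M_gt0 x01 c_ge1 x_le /andP[e_ge0 le_el] ev.
have x_gt0 : 0 < x by case/andP: x01.
have eM_ge0 : 0 <= e / M by rewrite divr_ge0 // ltW.
rewrite -powR_mulrn ?(ltW x_gt0) //.
apply: (@le_trans _ _ (x `^ (e / M))).
  by apply: ger_powR => //; rewrite ler_pdivrMr // mulrC.
apply: (@le_trans _ _ ((2 * (B / k) `^ d^-1) `^ (e / M))).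
  by apply: ge0_ler_powR; rewrite // nnegrE ?(ltW x_gt0) // mulr_ge0 // powR_ge0.
rewrite (powRM d^-1 (ltW B_gt0)) ?invr_ge0 ?(ltW k_gt0) // mulrA.
rewrite powRM ?mulr_ge0 ?powR_ge0 //.
have -> : (k^-1 `^ d^-1) `^ (e / M) = k `^ (- (M * d)^-1 * e).
  rewrite -powR_inv1 ?(ltW k_gt0) // -!powRrM; congr (_ `^ _).
  by rewrite invfM; ring.
apply: ler_wpM2r; first exact: powR_ge0.
by apply: ler_powR => //; rewrite ler_pM2r // invr_gt0.
Qed.

(** * Choice of constants and conclusion *)

Theorem theorem2p1 (R : realType) (r : nat) (VH : finType)
    (H : {set {set VH}}) (alpha A : R) :
  (2 <= r)%N ->
  uniform r H ->
  rpartite r H ->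
  (2 <= #|H|)%N ->
  0 < alpha ->
  0 < A ->
  r%:R ^+ (2 * r) <= A ->
  r%:R - (rdensity R r H)^-1 < alpha ->
  (forall n : nat, (ex r H n)%:R <= A * n%:R `^ alpha) ->
  exists k0 C : R, [/\ 0 < k0, 0 < C &
    forall (n : nat) (V : finType) (G : {set {set V}}) (k : R),
      (0 < n)%N -> #|V| = n -> uniform r G ->
      #|G|%:R = k * n%:R `^ alpha ->
      k0 <= k ->
      exists F : {set {set {set V}}},
        [/\ F != set0, F \subset copies H G &
          forall S : {set {set V}},
            S \subset G -> (1 <= #|S| <= #|H|)%N ->
            (codegree F S)%:R <=
              C * k `^ (- lambda r alpha H * (#|S|%:R - 1)) *
                (#|F|%:R / #|G|%:R)]].
Proof.
move=> r_ge2 unifH _ gt1H alpha_gt0 A_gt0 geA _ exH.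
have M_gt0 : 0 < rdensity R r H by exact: rdensity_gt0.
set M := rdensity R r H in M_gt0; set d := r%:R - alpha.
have H_gt0 : (0 < #|H|)%N by exact: ltnW.
have r_gt0 : (0 < r)%N by exact: ltnW.
have r_ge1 : 1 <= r%:R :> R by rewrite ler1n.
have cardG_le (n : nat) (V : finType) (G : {set {set V}}) :
    #|V| = n -> uniform r G -> #|G|%:R <= n%:R `^ r%:R :> R.
  by move=> <- unifG; rewrite powR_mulrn // -natrX ler_nat uniform_card_le.
(* When [r <= alpha] no [G] has [2 n ^ alpha] edges. *)
have [le_ralpha|lt_alphar] := leP r%:R alpha.
  exists 2, 1; split=> // n V G k n_gt0 cV unifG cG le2k; exfalso.
  have := cardG_le n V G cV unifG; rewrite cG leNgt => /negP; apply.
  have le_pow : n%:R `^ r%:R <= n%:R `^ alpha :> R by apply: ler_powR; rewrite // ler1n.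
  have pow_gt0 : 0 < n%:R `^ alpha :> R by rewrite powR_gt0 // ltr0n.
  nra.
have d_gt0 : 0 < d by rewrite subr_gt0.
(* With this [B], the edge condition of [copy_avoiding] follows from [B * n ^ d < k * t ^ d] after
   cancelling [n ^ alpha * t ^ alpha]. *)
pose B := 2 * A * r%:R ^+ r.
have rr_ge1 : 1 <= r%:R ^+ r :> R by exact: exprn_ege1.
have A_ge1 : 1 <= A by apply: le_trans geA; exact: exprn_ege1.
have B_ge : r%:R ^+ r <= B by rewrite /B; nra.
have B_gt0 : 0 < B by lra.
have c0_ge1 : 1 <= 2 * B `^ d^-1.
  have : 1 <= B `^ d^-1.
    rewrite -(powRr0 B); apply: ler_powR; first exact: le_trans rr_ge1 B_ge.
    by rewrite invr_ge0 ltW.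
  lra.
pose D := (2 * B `^ d^-1) `^ ((#|H|%:R - 1) / M).
have D_gt0 : 0 < D by rewrite powR_gt0 //; lra.
(* [D] is the constant of [sample_weight_le] for [l = #|H| - 1]. The powers of 2 pay for the subsets
   of a copy, the 2 in [sum_saturated_le] and the half in [copy_avoiding]. *)
pose C := 2 ^+ #|H|.+2 * D.
have C_gt0 : 0 < C by rewrite mulr_gt0 // exprn_gt0.
(* The first term is what [sample_size] requires; the added 1 ensures [k >= 1]. *)
exists (2 `^ d * B + 1), C; split=> //.
  by rewrite addr_gt0 // mulr_gt0 // powR_gt0.
move=> n V G k n_gt0 cV unifG cG le_k.
have two_gt0 : 0 < 2 `^ d * B by rewrite mulr_gt0 // powR_gt0.
have k_ge1 : 1 <= k by lra.
have k_gt0 : 0 < k by lra.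
have nR_gt0 : 0 < n%:R :> R by rewrite ltr0n.
have na_gt0 : 0 < n%:R `^ alpha :> R by rewrite powR_gt0.
have powS (x : R) : 0 < x -> x `^ r%:R = x `^ d * x `^ alpha.
  by move=> x_gt0; rewrite -powRD ?subrK // (gt_eqF x_gt0) implybT.
have k_le : k <= n%:R `^ d.
  by have := cardG_le n V G cV unifG; rewrite cG powS // ler_pM2r.
have m_gt0 : 0 < #|G|%:R :> R by rewrite cG mulr_gt0.
have rd_le : r%:R `^ d <= B.
  apply: le_trans B_ge; rewrite -powR_mulrn //; apply: ler_powR => //.
  by rewrite /d; lra.
have [] := @sample_size R n r B k d => //; first by lra.
move=> t [/andP[le_rt le_tn] lt_Bk le_q].
have t_gt0 : (0 < t)%N by exact: leq_trans le_rt.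
have tR_gt0 : 0 < t%:R :> R by rewrite ltr0n.
set lam := lambda r alpha H.
have lam_gt0 : 0 < lam by rewrite invr_gt0 mulr_gt0.
have k_neq0 : k != 0 by rewrite gt_eqF.
have kpow_gt0 x : 0 < k `^ x by exact: powR_gt0.
have kpowD x y : k `^ (x + y) = k `^ x * k `^ y by rewrite powRD // k_neq0 implybT.
pose DS j := k `^ (lam * (#|H|%:R - j%:R)).
(* [N] is the size for which [DS j] equals the claimed codegree bound with [N] in place of [#|F|]; a
   larger family only weakens that bound. *)
pose N := #|G|%:R * k `^ (lam * (#|H|%:R - 1)) / C.
have N_gt0 : 0 < N by rewrite divr_gt0 // mulr_gt0.
have DSE j : DS j = k `^ (- lam * (j%:R - 1)) * (N * C / #|G|%:R).
  rewrite /N divfK ?gt_eqF // mulrAC divff ?gt_eqF // mul1r -kpowD.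
  by congr (_ `^ _); ring.
have DSH : DS #|H| = 1 by rewrite /DS subrr mulr0 powRr0.
have DS_ge1 j : (0 < j <= #|H|)%N -> 1 <= DS j.
  move=> /andP[_ le_jH]; rewrite -[leLHS](powRr0 k); apply: ler_powR => //.
  by rewrite mulr_ge0 ?(ltW lam_gt0) // subr_ge0 ler_nat.
have [] := @balanced_family R VH V H G DS N => //; last first.
  move=> F [sF le_NF degF]; exists F; split=> //.
    rewrite -card_gt0 -(ltr0n R); exact: lt_le_trans le_NF.
  move=> S _ cS; apply: le_trans (degF S cS) _.
  rewrite DSE [leRHS](_ : _ = k `^ (- lam * (#|S|%:R - 1)) *
      (#|F|%:R * C / #|G|%:R)); last by ring.
  rewrite ler_wpM2l ?(ltW (kpow_gt0 _)) // ler_wpM2r ?invr_ge0 ?(ltW m_gt0) //.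
  by rewrite ler_wpM2r ?(ltW C_gt0).
move=> F sF lt_FN.
apply: (@copy_avoiding R r t) => //; rewrite ?cV //.
- by rewrite inE eqxx.
- by rewrite r_gt0.
- move=> S; rewrite inE => /and3P[S0 /codegree_gt0P[E EF sSE] _].
  apply: uniform_cover_ge S0; apply/forall_inP => e eS; apply: (forall_inP unifG).
  have := subsetP sF _ EF; rewrite inE => /andP[sEG _].
  exact: subsetP sEG _ (subsetP sSE _ eS).
(* Scaled by [c], the cap [DS #|S|] becomes exactly the weight bound of [sample_weight_le] with
   [e = #|S| - 1]. *)
- pose c := D * k `^ (- lam * (#|H|%:R - 1)).
  have c_gt0 : 0 < c by rewrite mulr_gt0.
  apply: le_trans (sum_saturated_le (c := c) sF (ltW c_gt0) _) _.
    move=> E S EF sSE S0; have copE := subsetP sF _ EF.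
    have -> : c * DS #|S| = D * k `^ (- lam * (#|S|%:R - 1)).
      by rewrite /c /DS -mulrA -kpowD; congr (_ * _ `^ _); ring.
    apply: sample_weight_le => //.
    + by rewrite divr_gt0 //= ler_pdivrMr // mul1r ler_nat.
    + rewrite subr_ge0 ler1n card_gt0 S0 lerD2r ler_nat -(copies_card copE).
      exact: subset_leq_card.
    + exact: copy_subset_density copE sSE S0.
  apply: le_trans (ler_wpM2r _ (ltW lt_FN)) _.
    by rewrite mulr_ge0 ?exprn_ge0 // mulr_ge0 // (ltW c_gt0).
  suff -> : N * (2 ^+ #|H| * (2 * c)) = #|G|%:R / 2 by [].
  have kk : k `^ (lam * (#|H|%:R - 1)) * k `^ (- lam * (#|H|%:R - 1)) = 1.
    by rewrite -kpowD mulNr subrr powRr0.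
  have p_neq0 : 2 ^+ #|H| != 0 :> R by rewrite expf_neq0 ?pnatr_eq0.
  have D_neq0 : D != 0 by rewrite gt_eqF.
  have cancel (g p D' x y : R) : p != 0 -> D' != 0 -> x * y = 1 ->
      g * x / (2 * (2 * p) * D') * (p * (2 * (D' * y))) = g / 2.
    move=> p0 D0 xy; rewrite -[RHS](mulr1 (g / 2)) -[X in g / 2 * X]xy.
    by field; rewrite p0 D0.
  by rewrite /N /C /c !exprS cancel.
(* After bounding [ex r H t] by [A * t ^ alpha], splitting [r = d + alpha] in the exponents reduces
   the goal to [lt_Bk]. *)
- rewrite natrM exprMn.
  have le_ex : 2 * (n%:R ^+ r * r%:R ^+ r) * (ex r H t)%:R <=
      n%:R `^ r%:R * (B * t%:R `^ alpha).
    rewrite powR_mulrn // /B.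
    apply: (@le_trans _ _ (2 * (n%:R ^+ r * r%:R ^+ r) * (A * t%:R `^ alpha))).
      by rewrite ler_wpM2l // !mulr_ge0 ?exprn_ge0.
    by rewrite le_eqVlt; apply/orP; left; apply/eqP; ring.
  apply: le_lt_trans le_ex _.
  rewrite -powR_mulrn // !powS // cG.
  have ta_gt0 : 0 < t%:R `^ alpha :> R by rewrite powR_gt0.
  have := ltr_pM2r (mulr_gt0 na_gt0 ta_gt0) (B * n%:R `^ d) (k * t%:R `^ d).
  by rewrite lt_Bk; set x := (_ `^ d); set y := (_ `^ d); lra.
Qed.
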